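(* Let $\Pi$ be a Poisson process on $\mathbb{L}$ with intensity $\alpha\cdot\mu$, where $\alpha>0$, and let $\mathcal{V}=\mathbb{T}\setminus\bigcup_{\ell\in\Pi}\ell$ be the vacant set. Set $\alpha_0=4\ln 2$. (i) If $\alpha<\alpha_0$, then almost surely $\mathcal{V}$ contains a line. (ii) If $\alpha\geq\alpha_0$, then almost surely $\mathcal{V}$ contains no half-line.
   Context: $\mathbb{T}$ is the $3$-regular tree with graph distance $d$, rooted at a vertex $\varnothing$. A line is the vertex set $\{x_n: n\in\mathbb{Z}\}$ of a bi-infinite geodesic path, i.e. $d(x_m,x_n)=|m-n|$ for all $m,n\in\mathbb{Z}$. $\mathbb{L}$ denotes the set of lines. A half-line is the vertex set $\{x_n:n\ge 0\}$ of an infinite geodesic path $(x_0,x_1,\dots)$ starting at any vertex. A ray is an infinite non-backtracking path $(\varnothing=x_0,x_1,\dots)$, and $\partial\mathbb{T}$ is the set of rays. For distinct rays $\xi,\eta$, $\xi\wedge\eta$ is the vertex farthest from the root common to both, and $\Lambda(\xi,\eta)\in\mathbb{L}$ is the line with ends $\xi$ and $\eta$. $\partial\mathbb{T}$ carries the metric $d(\xi,\eta)=2^{-|\xi\wedge\eta|}$ for $\xi\neq\eta$, where $|x|=d(\varnothing,x)$. $\mathbb{L}$ carries the final topology for the surjection $\Lambda$ from $(\partial\mathbb{T}\times\partial\mathbb{T})\setminus\mathrm{diagonal}$ onto $\mathbb{L}$, and its Borel $\sigma$-algebra. For vertices $x\neq y$, $\langle x,y\rangle$ is the set of lines passing through both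 $x$ and $y$. $\mu$ is the unique Borel measure on $\mathbb{L}$ invariant under all graph automorphisms of $\mathbb{T}$ with $\mu\langle x,y\rangle=2^{-d(x,y)}$ for all $x\neq y$. *)

(* Defs.v *)
From HB Require Import structures.
From mathcomp Require Import all_boot all_order all_algebra zify.
From mathcomp Require Import all_classical all_reals all_analysis.
Set Implicit Arguments. Unset Strict Implicit. Unset Printing Implicit Defensive.
Import Order.TTheory GRing.Theory Num.Theory.
Local Open Scope classical_set_scope.
Local Open Scope ring_scope.

(* Vertices: reduced words over the alphabet {0,1,2} (no two consecutive
   letters equal), i.e. the Cayley graph of Z/2 * Z/2 * Z/2, which is the
   3-regular tree. Root = empty word; x ~ y iff one is the other extended by
   one letter. The parent of a nonempty word is obtained by deleting its last
   letter, so |x| = size x. *)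
Definition reduced (s : seq 'I_3) : bool := sorted (fun a b => a != b) s.
Definition vertex := {s : seq 'I_3 | reduced s}.

Fixpoint lcp (s t : seq 'I_3) : nat :=
  match s, t with
  | a :: s', b :: t' => if a == b then (lcp s' t').+1 else 0
  | _, _ => 0
  end.

Definition dist (x y : vertex) : nat :=
  (size (val x) + size (val y) - (lcp (val x) (val y)).*2)%N.

Definition is_line (S : set vertex) : Prop :=
  exists x : int -> vertex,
    (forall m n : int, dist (x m) (x n) = absz (m - n)) /\ S = range x.

Definition is_half_line (S : set vertex) : Prop :=
  exists x : nat -> vertex,
    (forall m n : nat, dist (x m) (x n) = absz (m%:Z - n%:Z)) /\ S = range x.

(* an explicit line, used only to make the type of lines pointed *)
Fixpoint alt (b : bool) (n : nat) : seq 'I_3 :=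
  match n with
  | 0 => [::]
  | n'.+1 => (if b then (1 : 'I_3) else (0 : 'I_3)) :: alt (~~ b) n'
  end.

Lemma alt_reduced b n : reduced (alt b n).
Proof.
rewrite /reduced; elim: n b => [|n IH] b //=.
case: n IH => [|n] IH //=; rewrite /=.
have := IH (~~ b); rewrite /= => ->; rewrite andbT.
by case: b.
Qed.

Lemma lcp_alt_same b m n : lcp (alt b m) (alt b n) = minn m n.
Proof.
elim: m b n => [|m IH] b [|n] //=.
by rewrite eqxx IH minnSS.
Qed.

Lemma lcp_alt_diff b m n : lcp (alt b m) (alt (~~ b) n) = 0%N.
Proof. by case: m => [|m] //; case: n => [|n] //=; case: b. Qed.

Lemma size_alt b n : size (alt b n) = n.
Proof. by elim: n b => [|n IH] b //=; rewrite IH. Qed.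

Definition alt_v (b : bool) (n : nat) : vertex := exist _ (alt b n) (alt_reduced b n).

Definition line0_fun (z : int) : vertex :=
  match z with Posz n => alt_v false n | Negz n => alt_v true n.+1 end.

Lemma dist_alt_same b m n : dist (alt_v b m) (alt_v b n) = absz (m%:Z - n%:Z).
Proof.
rewrite /dist /= !size_alt lcp_alt_same -addnn.
rewrite /minn; case: ltnP => h; lia.
Qed.

Lemma dist_alt_diff b m n : dist (alt_v b m) (alt_v (~~ b) n) = (m + n)%N.
Proof. by rewrite /dist /= !size_alt lcp_alt_diff subn0. Qed.

Lemma line0_is_line : is_line (range line0_fun).
Proof.
exists line0_fun; split => // [[m|m] [n|n]]; rewrite /line0_fun.
- by rewrite dist_alt_same.
- rewrite (dist_alt_diff false) NegzE; lia.
- have := dist_alt_diff true m.+1 n; rewrite /= => ->; rewrite NegzE; lia.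
- rewrite dist_alt_same !NegzE; lia.
Qed.

Definition line := {S : set vertex | is_line S}.
HB.instance Definition _ := gen_eqMixin line.
HB.instance Definition _ := gen_choiceMixin line.
HB.instance Definition _ :=
  isPointed.Build line (exist _ (range line0_fun) line0_is_line).

(* rays from the root: non-backtracking letter sequences *)
Definition ray := {r : nat -> 'I_3 | forall n, r n != r n.+1}.

Definition pref (r : ray) (n : nat) : seq 'I_3 := mkseq (sval r) n.

(* Lambda(xi, eta): the line with ends xi and eta (for xi <> eta) *)
Definition Lambda (xi eta : ray) : set vertex :=
  [set x | (exists n, val x = pref xi n \/ val x = pref eta n) /\
           pref xi (size (val x)).+1 <> pref eta (size (val x)).+1].

(* xi and xi' agree on the first n letters, i.e. d(xi,xi') <= 2^-n *)
Definition agree (xi xi' : ray) (n : nat) : Prop :=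
  forall i, (i < n)%N -> sval xi i = sval xi' i.

(* U is open in the final topology of Lambda : (dT x dT) \ diag -> L, where
   dT carries the metric 2^{-|xi /\ eta|} (balls = cylinders) *)
Definition openL (U : set line) : Prop :=
  forall (xi eta : ray) (l : line), xi <> eta -> proj1_sig l = Lambda xi eta -> U l ->
  exists n, forall (xi' eta' : ray) (l' : line), xi' <> eta' ->
    agree xi xi' n -> agree eta eta' n -> proj1_sig l' = Lambda xi' eta' -> U l'.

Definition Lm := g_sigma_algebraType openL.

Definition lines_through (x y : vertex) : set Lm := [set l | proj1_sig l x /\ proj1_sig l y].

Definition poisson_process {d} {Omega : measurableType d} {R : realType}
  (P : probability Omega R) (alpha : R) (mu : {measure set Lm -> \bar R})
  (Pi : Omega -> set Lm) : Prop :=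
  forall (n : nat) (A : 'I_n -> set Lm) (k : 'I_n -> nat),
    (forall i, measurable (A i)) ->
    (forall i, (mu (A i) < +oo)%E) ->
    (forall i j, i != j -> A i `&` A j = set0) ->
    measurable [set w | forall i, ((Pi w `&` A i) #= `I_(k i))%card] /\
    P [set w | forall i, ((Pi w `&` A i) #= `I_(k i))%card] =
      (\prod_(i < n)
         (expR (- (alpha * fine (mu (A i)))) *
          (alpha * fine (mu (A i))) ^+ (k i) / (k i)`!%:R))%:E.

Definition vacant (Pi : set Lm) : set vertex :=
  [set x | forall l : Lm, Pi l -> ~ proj1_sig l x].

(* Main.v *)
(* A line through a vertex [x] other than the root either passes through the
   parent of [x] or has its apex at [x], in which case it passes through both
   children of [x]; the set of the latter lines has measure 1/4. Hence, as soon as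
   [x] is vacant, its children are vacant independently with probability
   [p = exp (- alpha / 4)], and vacant descending paths are the infinite paths of a
   Galton-Watson tree with Bin(2, p) offspring. It survives iff [p > 1/2], that is
   iff [alpha < 4 ln 2], and every half-line is eventually descending, which
   settles (ii).
   For (i), take many far apart vertices [y_1, .., y_m], none an ancestor of
   another. A vacant line turns at [y_k] as soon as no line of the process uses the
   edge from [y_k] to its parent, none has its apex at [y_k], and both children of
   [y_k] survive. Up to the lines through two of the [y_k], whose total measure is
   small, these are independent events of probability bounded below. *)
Require Import Defs.
From HB Require Import structures.
From mathcomp Require Import all_boot all_order all_algebra zify ring lra.
From mathcomp Require Import all_classical all_reals all_analysis.
Import Order.TTheory GRing.Theory Num.Theory.
Import numFieldNormedType.Exports.
Local Open Scope classical_set_scope.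
Local Open Scope ring_scope.

(** * Geometry of lines in the tree *)

Lemma lcp_le (s t : seq 'I_3) : (lcp s t <= size s)%N /\ (lcp s t <= size t)%N.
Proof.
elim: s t => [|a s IH] [|b t] //=; case: eqP => // _; have := IH t; lia.
Qed.

Lemma take_lcp (s t : seq 'I_3) : take (lcp s t) s = take (lcp s t) t.
Proof. by elim: s t => [|a s IH] [|b t] //=; case: eqP => [-> /=|//]; rewrite IH. Qed.

Lemma lcp_sym (s t : seq 'I_3) : lcp s t = lcp t s.
Proof. by elim: s t => [|a s IH] [|b t] //=; rewrite eq_sym IH. Qed.

Lemma lcp_cat (u s t : seq 'I_3) : lcp (u ++ s) (u ++ t) = (size u + lcp s t)%N.
Proof. by elim: u => //= a u ->; rewrite eqxx. Qed.

Lemma lcp_not_prefix (x t v : seq 'I_3) : ~~ prefix x v -> lcp v (x ++ t) = lcp v x.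
Proof.
elim: x v => [|a x IH] [|b v] //=; rewrite eq_sym.
by case: eqP => //= _ /IH ->.
Qed.

Lemma dist_sym (x y : vertex) : dist x y = dist y x.
Proof. by rewrite /dist lcp_sym addnC. Qed.

Lemma dist_prefix (x y : vertex) :
  prefix (val x) (val y) -> dist x y = (size (val y) - size (val x))%N.
Proof.
case/prefixP => t yE; rewrite /dist yE -[X in lcp X _]cats0 lcp_cat size_cat /=.
by case: t {yE} => [|b t] /=; lia.
Qed.

Lemma dist1_rcons (x y : vertex) : dist x y = 1%N ->
  (exists a, val x = rcons (val y) a) \/ (exists a, val y = rcons (val x) a).
Proof.
wlog le_yx : x y / (size (val y) <= size (val x))%N => [H|d1].
  have [/H //|lt] := leqP (size (val y)) (size (val x)).
  rewrite dist_sym => /(H _ _ (ltnW lt)); tauto.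
left; have [h1 h2] := lcp_le (val x) (val y).
have lE : lcp (val x) (val y) = size (val y) by move: d1; rewrite /dist; lia.
have xE : size (val x) = (size (val y)).+1 by move: d1; rewrite /dist; lia.
have := take_lcp (val x) (val y); rewrite lE take_size.
case/lastP: (val x) xE => [//|s a]; rewrite size_rcons => -[<-].
by rewrite -cats1 take_size_cat // => <-; exists a; rewrite cats1.
Qed.

(** * Children and the ancestor order *)

Lemma reduced_rcons (s : seq 'I_3) a b :
  reduced (rcons (rcons s a) b) = reduced (rcons s a) && (a != b).
Proof.
rewrite /reduced; case: s => [|c s] /=; first by rewrite andbT.
by rewrite rcons_path last_rcons.
Qed.

(** Addition in ['I_3] is modulo 3, so the two values are the two letters other than [a]. *)
Definition next_letter (b : bool) (a : 'I_3) : 'I_3 := if b then a + 1 else a + 2.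

Lemma next_letter_neq a : (next_letter true a == next_letter false a) = false.
Proof. by case: a => -[|[|[|//]]]. Qed.

Lemma child_reduced (b : bool) (x : vertex) :
  reduced (rcons (val x) (next_letter b (last 0 (val x)))).
Proof.
case: x => s /=; case/lastP: s => [|s a] // ra; rewrite last_rcons reduced_rcons ra /=.
by case: b; case: a ra => -[|[|[|//]]].
Qed.

(* For the root this gives only two of its three neighbours. *)
Definition child (b : bool) (x : vertex) : vertex :=
  exist _ (rcons (val x) (next_letter b (last 0 (val x)))) (child_reduced b x).

Lemma size_child b x : size (val (child b x)) = (size (val x)).+1.
Proof. by rewrite size_rcons. Qed.

Lemma child_neq x : child true x <> child false x.
Proof.
move=> /(congr1 (fun v : vertex => last 0 (val v)))/=; rewrite !last_rcons.
by move/eqP; rewrite next_letter_neq.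
Qed.

Lemma rcons_child (x y : vertex) a :
  val x <> [::] -> val y = rcons (val x) a -> exists b, y = child b x.
Proof.
move=> x0 yE; have := valP y; rewrite yE.
suff : reduced (rcons (val x) a) -> exists b, a = next_letter b (last 0 (val x)).
  by move=> H /H[b ab]; exists b; apply: val_inj; rewrite yE ab.
case/lastP: (val x) x0 => [//|s c] _; rewrite last_rcons reduced_rcons => /andP[_ ca].
have [->|ne] := eqVneq a (next_letter true c); [by exists true|exists false].
apply/val_inj; move: ne ca; rewrite -!val_eqE.
by case: c => -[|[|[|//]]] ?; case: a {yE} => -[|[|[|//]]] ?.
Qed.

Definition prec (x y : vertex) : bool := prefix (val x) (val y).

Lemma val_child b x : val (child b x) = val x ++ [:: next_letter b (last 0 (val x))].
Proof. by rewrite cats1. Qed.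

Lemma prec_child b x : prec x (child b x).
Proof. exact: prefix_rcons. Qed.

Lemma prec_trans x y z : prec x y -> prec y z -> prec x z.
Proof. exact: prefix_trans. Qed.

Lemma prec_comparable x y z : prec x z -> prec y z -> prec x y \/ prec y x.
Proof.
wlog xy : x y / (size (val x) <= size (val y))%N => [H|].
  have [/H //|/ltnW yx px py] := leqP (size (val x)) (size (val y)).
  by case: (H _ _ yx py px); [right|left].
rewrite /prec !prefixE => /eqP px /eqP py; left.
by rewrite -{1}py take_takel // px.
Qed.

Lemma dist_child_out b (x v : vertex) : ~~ prec x v -> dist v (child b x) = (dist v x).+1.
Proof.
move=> nxv; rewrite /dist val_child lcp_not_prefix // size_cat addnA addn1.
by have [h1 h2] := lcp_le (val v) (val x); rewrite subSn // -addnn leq_add.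
Qed.

Lemma dist_children x : dist (child true x) (child false x) = 2%N.
Proof.
rewrite /dist !val_child lcp_cat !size_cat [lcp [:: _] _]/= next_letter_neq /=; lia.
Qed.

Lemma children_prec (x v : vertex) : prec (child true x) v -> prec (child false x) v -> False.
Proof.
rewrite /prec !prefixE => /eqP h1 /eqP h2; apply: (@child_neq x); apply: val_inj.
by rewrite -h1 -h2 /= !size_rcons.
Qed.

Lemma child_Nprec b (x : vertex) : ~~ prec (child b x) x.
Proof. by apply/negP => /size_prefix; rewrite size_child ltnn. Qed.

(** * How a line passes through a vertex *)

Lemma line_pt {l : line} {v w : vertex} : sval l v -> sval l w -> exists f : int -> vertex,
  exists m n, [/\ forall m n : int, dist (f m) (f n) = absz (m - n),
    sval l = range f, v = f m & w = f n].
Proof.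
case: l => S /= [f [fd ->]] [m _ <-] [n _ <-]; by exists f, m, n.
Qed.

Lemma line_neighbours (l : line) v : sval l v -> exists u w,
  [/\ sval l u, sval l w, dist v u = 1%N, dist v w = 1%N & u <> w].
Proof.
move=> lv; have [f [m [_ [fd lE vE _]]]] := line_pt lv lv.
exists (f (m - 1)), (f (m + 1)); rewrite lE vE !fd; split; try (by eexists); try lia.
by move=> /(congr1 (dist (f (m - 1)))); rewrite !fd; lia.
Qed.

(** The two neighbours of [v] on the line are distinct. With the parent excluded both are children
    of [v], and [v], not being the root, has only two. *)
Lemma line_both_children (l : line) (v p : vertex) a :
  sval l v -> val v = rcons (val p) a -> ~ sval l p -> forall b, sval l (child b v).
Proof.
move=> lv vE lp.
have v0 : val v <> [::] by rewrite vE; case: (val p).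
have nb u : sval l u -> dist v u = 1%N -> exists b, u = child b v.
  move=> lu /dist1_rcons[[c]|[c /(rcons_child v u c v0)//]].
  by rewrite vE => /rcons_inj[/val_inj pu]; case: lp; rewrite pu.
have [u [w [lu lw /(nb _ lu)[bu uE] /(nb _ lw)[bw wE] uw]]] := line_neighbours l v lv.
move: uw lu lw; rewrite {}uE {}wE.
by case: bu; case: bw => // _ lu lw [].
Qed.

(** A vertex outside the subtree of [x] is equally far from both children of [x]. On the line only
    the midpoint between the children has this property, and the midpoint is [x]. *)
Lemma line_through_children (l : line) x : sval l (child true x) -> sval l (child false x) ->
  sval l x /\ forall v, sval l v -> prec x v.
Proof.
move=> l1 l2; have [f [m [n [fd lE E1 E2]]]] := line_pt l1 l2.
have mn : absz (m - n) = 2%N by rewrite -fd -E1 -E2 dist_children.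
(* The children are at distance 2, so a point of the line equidistant from them is adjacent to both,
   hence is their common parent. *)
have mid k : absz (k - m) = absz (k - n) -> f k = x.
  move=> kk; have k1 : absz (k - m) = 1%N by lia.
  have k2 : absz (k - n) = 1%N by lia.
  move: k1 k2; rewrite -!fd -E1 -E2 => /dist1_rcons[[a aE]|[a /rcons_inj[/val_inj//]]].
  move=> /dist1_rcons[[b bE]|[a' /rcons_inj[/val_inj//]]].
  move: aE; rewrite bE => /rcons_inj e; case: (@child_neq x).
  by apply: val_inj; case: e.
split.
  have [k kk] : exists k : int, absz (k - m) = absz (k - n).
    have [h|h] : m = n + 2 \/ n = m + 2 by lia.
      by exists (n + 1); lia.
    by exists (m + 1); lia.
  by rewrite lE -(mid _ kk); eexists.
rewrite lE => _ [k _ <-]; apply/negPn/negP => nk.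
have kk : absz (k - m) = absz (k - n) by rewrite -!fd -E1 -E2 !dist_child_out.
by move: nk; rewrite mid // /prec prefix_refl.
Qed.

(** * Measurable sets of lines; lines inside a subtree *)

Definition hits (x : vertex) : set Lm := [set l | sval l x].

Lemma pref_agree (xi xi' : ray) n k : agree xi xi' n -> (k <= n)%N -> pref xi k = pref xi' k.
Proof.
move=> ag kn; apply/eq_in_map => i; rewrite mem_iota add0n /= => ik; apply: ag; lia.
Qed.

(** Whether a line hits [x] is decided by the first |x| + 1 letters of its two ends, so [hits x] is
    open. *)
Lemma measurable_hits x : measurable (hits x).
Proof.
apply: sub_gen_smallest => xi eta l ne lE; rewrite /hits /= lE => -[[k xk] nxi].
exists (size (val x)).+1 => xi' eta' l' ne' a1 a2 lE'; rewrite /hits /= lE'.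
rewrite /Lambda /= -(pref_agree xi xi' _ _ a1 (leqnn _)) -(pref_agree eta eta' _ _ a2 (leqnn _)).
split=> //; exists (size (val x)).
have kE : k = size (val x) by case: xk => ->; rewrite size_mkseq.
rewrite -(pref_agree xi xi' _ _ a1 (leqnSn _)) -(pref_agree eta eta' _ _ a2 (leqnSn _)).
by rewrite -[in pref _ _]kE -[in pref eta _]kE.
Qed.

Lemma measurable_lines_through x y : measurable (lines_through x y).
Proof. exact: (measurableI _ _ (measurable_hits x) (measurable_hits y)). Qed.

Definition apexed (x : vertex) : set Lm := lines_through (child true x) (child false x).
Definition below (x : vertex) : set Lm := [set l | forall v, sval l v -> prec x v].

Lemma apexed_below x : apexed x `<=` below x.
Proof. by move=> l [l1 l2]; have [] := line_through_children l x l1 l2. Qed.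

Lemma below_child b x : below (child b x) `<=` below x.
Proof. by move=> l bl v /bl; apply: prec_trans; exact: prec_child. Qed.

Lemma apexed_below_child b x : apexed x `&` below (child b x) = set0.
Proof.
apply/seteqP; split=> // l [[l1 l2] bl]; have [lx _] := line_through_children l x l1 l2.
by have := bl _ lx; rewrite (negbTE (child_Nprec _ _)).
Qed.

Lemma line_inh (l : line) : exists v, sval l v.
Proof. by case: l => S [f [fd /= ->]]; exists (f 0), 0. Qed.

Lemma below_children x : below (child true x) `&` below (child false x) = set0.
Proof.
apply/seteqP; split=> // l [l1 l2]; have [v lv] := line_inh l.
exact: (children_prec x v (l1 _ lv) (l2 _ lv)).
Qed.

(** * Descending paths, and lines made of two of them *)

Definition descending (g : nat -> vertex) := forall n, exists b, g n.+1 = child b (g n).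

(** After one step away from the root a geodesic cannot step back, since the parent is the vertex it
    came from. It cannot approach the root for ever either, because the depth drops at each such
    step. *)
Lemma half_line_descending (H : set vertex) : is_half_line H ->
  exists g, [/\ descending g, val (g 0%N) <> [::] & forall n, H (g n)].
Proof.
move=> [f [fd ->]].
have f1 n : dist (f n) (f n.+1) = 1%N by rewrite fd; lia.
pose up n := exists a, val (f n.+1) = rcons (val (f n)) a.
have upS n : up n -> up n.+1.
  move=> [a fa]; case: (dist1_rcons _ _ (f1 n.+1)) => // -[b].
  rewrite fa => /rcons_inj[/val_inj e _]; have : dist (f n) (f n.+2) = 2%N by rewrite fd; lia.
  by rewrite -e /dist; have := fd n n; rewrite /dist => ->; rewrite subrr.
have [N upN] : exists n, up n.
  apply: contrapT => nup.
  have sz n : (size (val (f n)) + n)%N = size (val (f 0%N)).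
    elim: n => [|n <-]; first by rewrite addn0.
    case: (dist1_rcons _ _ (f1 n)) => -[a e]; last by case: nup; exists n, a.
    by rewrite e size_rcons addnS addSn.
  by have := sz (size (val (f 0%N))).+1; lia.
have up_ge k : up (N + k)%N by elim: k => [|k IH]; rewrite ?addn0 ?addnS //; exact: upS.
(* The shift by one keeps the path off the root, so that every further letter leads to a [child]. *)
exists (fun k => f (N + k).+1); split=> [k||k]; last by eexists.
- have [a] := up_ge k.+1; rewrite addnS => /rcons_child; apply.
  by have [b ->] := up_ge k; case: (val (f _)).
- by rewrite addn0; have [b ->] := upN; case: (val (f _)).
Qed.

Section Descending.
Variable g : nat -> vertex.
Hypothesis gd : descending g.

Lemma descending_size n : size (val (g n)) = (size (val (g 0%N)) + n)%N.
Proof.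
by elim: n => [|n IH]; rewrite ?addn0 //; have [b ->] := gd n; rewrite size_child IH addnS.
Qed.

Lemma descending_prec m n : (m <= n)%N -> prec (g m) (g n).
Proof.
move=> /subnK <-; elim: (n - m)%N => [|k IH]; first exact: prefix_refl.
by rewrite addSn; have [b ->] := gd (k + m)%N; apply: prec_trans IH _; exact: prec_child.
Qed.

Lemma descending_dist m n : dist (g m) (g n) = absz (m%:Z - n%:Z).
Proof.
wlog mn : m n / (m <= n)%N => [H|].
  have [/H //|/ltnW nm] := leqP m n; rewrite dist_sym (H n m nm); lia.
rewrite dist_prefix; last exact: descending_prec.
have := descending_size m; have := descending_size n; lia.
Qed.
End Descending.

(** The paths part at once, so their later words share exactly the prefix [g 0] and distances add up
    through that vertex. *)
Lemma descending_pair_dist (g h : nat -> vertex) : descending g -> descending h ->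
  h 0%N = g 0%N -> g 1%N = child true (g 0%N) -> h 1%N = child false (g 0%N) ->
  forall m n, dist (g m) (h n) = (m + n)%N.
Proof.
move=> gd hd h0 g1 h1 [|m] [|n].
- by rewrite h0 descending_dist.
- by rewrite -h0 descending_dist //; lia.
- by rewrite h0 descending_dist //; lia.
have := descending_prec _ gd 1 m.+1 isT; have := descending_prec _ hd 1 n.+1 isT.
have := descending_size _ gd m.+1; have := descending_size _ hd n.+1.
rewrite /prec g1 h1 h0 !val_child => sh sg /prefixP[t hE] /prefixP[s gE].
rewrite /dist sh sg hE gE -!catA lcp_cat [lcp ([:: _] ++ _) _]/= next_letter_neq.
lia.
Qed.

Lemma descending_pair_line (g h : nat -> vertex) : descending g -> descending h ->
  h 0%N = g 0%N -> g 1%N = child true (g 0%N) -> h 1%N = child false (g 0%N) ->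
  exists l : line, forall v, sval l v -> exists n, v = g n \/ v = h n.
Proof.
move=> gd hd h0 g1 h1; have gh := @descending_pair_dist g h gd hd h0 g1 h1.
pose f (z : int) := match z with Posz n => g n | Negz n => h n.+1 end.
have fl : is_line (range f).
  exists f; split=> // -[m|m] [n|n]; rewrite /f.
  - exact: descending_dist.
  - by rewrite gh NegzE; lia.
  - by rewrite dist_sym gh NegzE; lia.
  - by rewrite descending_dist // !NegzE; lia.
exists (exist _ _ fl) => v /= [[n|n] _ <-] /=; first by exists n; left.
by exists n.+1; right.
Qed.

(** * Incomparable vertices far apart *)

Lemma alt_rcons_reduced b n : reduced (rcons (alt b n) (2 : 'I_3)).
Proof.
rewrite /reduced; elim: n b => [|n IH] b //=.
by case: n IH => [|n] IH /=; [case: b|have := IH (~~ b); rewrite /= => ->; case: b].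
Qed.

(* Hangs off the ray 0101.. at depth [n]. *)
Definition side (n : nat) : vertex :=
  exist _ (rcons (alt false n) (2 : 'I_3)) (alt_rcons_reduced false n).

(** The 2 counts the edges joining the two vertices to the ray. *)
Lemma dist_side m n : m <> n -> dist (side m) (side n) = (absz (m%:Z - n%:Z) + 2)%N.
Proof.
wlog mn : m n / (m < n)%N => [H ne|_].
  have [/H->//|nm] := ltnP m n.
  by rewrite dist_sym H; lia.
have l b k i : lcp (rcons (alt b k) (2 : 'I_3)) (rcons (alt b (k + i.+1)) (2 : 'I_3)) = k.
  elim: k b => [|k IH] b /=; first by case: b.
  by rewrite eqxx IH.
have [i ->] : exists i, n = (m + i.+1)%N by exists (n - m.+1)%N; lia.
rewrite /dist /= !size_rcons !size_alt l; lia.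
Qed.

Lemma side_Nprec m n : m <> n -> ~~ prec (side m) (side n).
Proof.
move=> ne; apply/negP => /dist_prefix; rewrite dist_side //= !size_rcons !size_alt; lia.
Qed.

(** * Events determined by a set of lines *)

Section Avoidance.
Context {R : realType} {mu : {measure set Lm -> \bar R}} {d : measure_display}
  {Omega : measurableType d} {P : probability Omega R} {alpha : R} {Pi : Omega -> set Lm}.
Hypothesis alpha_gt0 : 0 < alpha.
Hypothesis PiP : poisson_process P alpha mu Pi.

Definition avoid (A : set Lm) : set Omega := [set w | Pi w `&` A = set0].
Definition fin_meas (A : set Lm) := measurable A /\ (mu A < +oo)%E.
Definition void_prob (A : set Lm) : R := expR (- (alpha * fine (mu A))).
Definition Pr (E : set Omega) : R := fine (P E).

(** The Poisson law enters only here, for one set and count zero. Independence over disjoint sets is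
    recovered from [avoidU] and [void_probU]. *)
Lemma avoidP A : fin_meas A -> measurable (avoid A) /\ Pr (avoid A) = void_prob A.
Proof.
move=> [mA fA].
have [||i j|] := PiP 1%N (fun=> A) (fun=> 0%N); [by []|by []|by rewrite (ord1 i) (ord1 j)|].
have -> : [set w | forall _ : 'I_1, ((Pi w `&` A) #= `I_0)%card] = avoid A.
  apply/seteqP; split=> [w /(_ ord0)|w aw _ /=]; rewrite II0 ?card_eq0 ?aw //.
  by move/eqP.
by rewrite big_ord1 expr0 fact0 invr1 !mulr1 /Pr => mE ->.
Qed.

Lemma avoidU A B : avoid (A `|` B) = avoid A `&` avoid B.
Proof.
by apply/funext => w; rewrite /avoid /= setIUr setU_eq0.
Qed.

Lemma fin_measU A B : fin_meas A -> fin_meas B -> fin_meas (A `|` B).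
Proof.
move=> [mA fA] [mB fB]; split; first exact: measurableU.
by apply: (le_lt_trans (measureU2 mu mA mB)); exact: lte_add_pinfty.
Qed.

Lemma void_probU A B : fin_meas A -> fin_meas B -> A `&` B = set0 ->
  void_prob (A `|` B) = void_prob A * void_prob B.
Proof.
move=> [mA fA] [mB fB] AB; rewrite /void_prob -expRD measureU //.
by rewrite fineD ?ge0_fin_numE // mulrDr opprD.
Qed.

Lemma Pr_ge0 E : 0 <= Pr E.
Proof. exact: fine_ge0. Qed.

Lemma PrE E : measurable E -> P E = (Pr E)%:E.
Proof. by move=> mE; rewrite fineK // fin_num_measure. Qed.

Lemma Pr_le E F : measurable E -> measurable F -> E `<=` F -> Pr E <= Pr F.
Proof. by move=> mE mF EF; rewrite -lee_fin -!PrE // le_measure ?inE. Qed.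

Lemma PrT : Pr setT = 1.
Proof. by rewrite /Pr probability_setT. Qed.

Lemma PrC E B : measurable E -> measurable B -> Pr (~` E `&` B) = Pr B - Pr (E `&` B).
Proof.
move=> mE mB; apply: EFin_inj; rewrite EFinB -!PrE //.
- by rewrite setIC -setDE measureD ?(setIC B) // ltey_eq fin_num_measure.
- exact: measurableI.
- by apply: measurableI => //; exact: measurableC.
Qed.

Lemma PrU E F : measurable E -> measurable F -> Pr (E `|` F) <= Pr E + Pr F.
Proof.
move=> mE mF; rewrite -lee_fin EFinD -!PrE //; first exact: measureU2.
exact: measurableU.
Qed.

Definition indep_of (X : set Lm) (B : set Omega) := measurable B /\
  forall A, fin_meas A -> A `<=` X -> Pr (avoid A `&` B) = void_prob A * Pr B.

(* Stands for: [E] has probability [e] and is determined by the lines in [X]. Only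
   void probabilities are needed, and testing against the events independent of
   the lines in [X] makes the notion stable under Boolean operations and limits. *)
Definition local_event (X : set Lm) (E : set Omega) (e : R) := measurable E /\
  forall B, indep_of X B -> Pr (E `&` B) = e * Pr B.

Lemma indep_of_sub X Y B : X `<=` Y -> indep_of Y B -> indep_of X B.
Proof. by move=> XY [mB iB]; split=> // A fA AX; apply: iB => //; exact: subset_trans XY. Qed.

(** Avoiding a subset of [Y] and [A] together is avoiding their disjoint union, whose void
    probability factors. *)
Lemma indep_of_avoid X Y A B : X `&` Y = set0 -> fin_meas A -> A `<=` X ->
  indep_of (X `|` Y) B -> indep_of Y (avoid A `&` B).
Proof.
move=> XY fA AX [mB iB]; have [mE _] := avoidP _ fA.
split=> [|A' fA' A'Y]; first exact: measurableI.
have AA' : A' `&` A = set0.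
  by apply/seteqP; split=> // l [/A'Y ly /AX lx]; rewrite -XY.
rewrite setIA -avoidU iB; first last.
- by move=> l [/A'Y|/AX]; [right|left].
- exact: fin_measU.
by rewrite (iB A) ?void_probU ?mulrA //; apply: subset_trans AX _ => l; left.
Qed.

(** The factor [e] splits off both from [B] and from [B] cut with a void event in [Y], which by
    [indep_of_avoid] is still a valid test event for [X]. *)
Lemma local_event_indep X Y E e B : X `&` Y = set0 -> local_event X E e ->
  indep_of (X `|` Y) B -> indep_of Y (E `&` B).
Proof.
move=> XY [mE lE] iB; have mB := iB.1; split=> [|A fA AY]; first exact: measurableI.
have YX : Y `&` X = set0 by rewrite setIC.
rewrite setICA lE; last by apply: (@indep_of_avoid Y X) => //; rewrite setUC.
rewrite lE; last exact: indep_of_sub iB.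
by rewrite iB.2 //; [rewrite mulrCA|apply: subset_trans AY _ => l; right].
Qed.

Lemma local_event_sub X Y E e : X `<=` Y -> local_event X E e -> local_event Y E e.
Proof. by move=> XY [mE lE]; split=> // B iB; apply: lE; exact: indep_of_sub iB. Qed.

Lemma local_event_avoid A : fin_meas A -> local_event A (avoid A) (void_prob A).
Proof. by move=> fA; split=> [|B [mB]]; [have [] := avoidP _ fA|exact]. Qed.

Lemma local_eventC X E e : local_event X E e -> local_event X (~` E) (1 - e).
Proof.
move=> [mE lE]; split=> [|B iB]; first exact: measurableC.
by rewrite PrC ?lE // ?mulrBl ?mul1r //; exact: iB.1.
Qed.

(** [F] cut with [B] is again a test event for [X], so [e] and then [f] split off. *)
Lemma local_eventI X Y E F e f : X `&` Y = set0 -> local_event X E e ->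
  local_event Y F f -> local_event (X `|` Y) (E `&` F) (e * f).
Proof.
move=> XY lE lF; split=> [|B iB]; first exact: measurableI lE.1 lF.1.
rewrite -setIA lE.2; last first.
  apply: (@local_event_indep Y X _ f) => //; first by rewrite setIC.
  by rewrite setUC.
by rewrite lF.2 ?mulrA //; apply: indep_of_sub iB => l; right.
Qed.

Lemma local_eventU X Y E F e f : X `&` Y = set0 -> local_event X E e ->
  local_event Y F f -> local_event (X `|` Y) (E `|` F) (1 - (1 - e) * (1 - f)).
Proof.
move=> XY /local_eventC lE /local_eventC lF.
by rewrite -[E `|` F]setCK setCU; apply/local_eventC/local_eventI.
Qed.

Lemma local_event_Pr X E e : local_event X E e -> Pr E = e.
Proof.
move=> [_ lE]; rewrite -[E]setIT lE ?PrT ?mulr1 //; split=> // A fA _.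
by rewrite setIT PrT mulr1 (avoidP _ fA).2.
Qed.

Lemma Pr_bigcap_cvg (F : (set Omega)^nat) : (forall n, measurable (F n)) ->
  (forall n, F n.+1 `<=` F n) -> Pr \o F @ \oo --> Pr (\bigcap_n F n).
Proof.
move=> mF dF; apply: fine_cvg; rewrite -PrE; last exact: bigcapT_measurable.
apply: nonincreasing_cvg_mu => //.
- by rewrite ltey_eq fin_num_measure.
- exact: bigcapT_measurable.
- by apply/nonincreasing_seqP => n; apply/subsetPset.
Qed.

Lemma local_event_bigcap X (F : (set Omega)^nat) (e : R^nat) c :
  (forall n, local_event X (F n) (e n)) -> (forall n, F n.+1 `<=` F n) ->
  e @ \oo --> c -> local_event X (\bigcap_n F n) c.
Proof.
move=> lF dF ec; have mF n := (lF n).1.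
split=> [|B iB]; first exact: bigcapT_measurable.
have h := @Pr_bigcap_cvg (fun n => F n `&` B) (fun n => measurableI _ _ (mF n) iB.1)
  (fun n => @setSI _ B _ _ (dF n)).
rewrite bigcapIl in h; last by exists 0%N.
apply: (cvg_unique _ h); first exact: norm_hausdorff.
have -> : Pr \o (fun n => F n `&` B) = (fun n => e n * Pr B).
  by apply/funext => n; rewrite /= (lF n).2.
by apply: cvgM => //; exact: cvg_cst.
Qed.

(** * The Galton-Watson tree and its survival probability *)

Hypothesis muE : forall x y : vertex, x <> y ->
  mu (lines_through x y) = ((2 : R) ^- dist x y)%:E.

Lemma lines_through_void x y : x <> y -> fin_meas (lines_through x y) /\
  void_prob (lines_through x y) = expR (- (alpha * 2 ^- dist x y)).
Proof.
move=> xy; rewrite /fin_meas /void_prob muE //.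
by split=> //; split; [exact: measurable_lines_through|rewrite ltry].
Qed.

Definition open_prob : R := expR (- (alpha / 4)).

Lemma apexed_void x : fin_meas (apexed x) /\ void_prob (apexed x) = open_prob.
Proof.
have [//|fA ->] := lines_through_void (child true x) (child false x).
  exact: child_neq.
split=> //; rewrite dist_children /open_prob; congr (expR (- (alpha * _^-1))).
by rewrite expr2; ring.
Qed.

(** Survival for [n] generations: some descending path of [n] vertices from [x] carries no apex of a
    line of the process. *)
Fixpoint desc (n : nat) (x : vertex) : set Omega :=
  if n is m.+1 then
    avoid (apexed x) `&` (desc m (child true x) `|` desc m (child false x))
  else setT.

Fixpoint desc_prob (n : nat) : R :=
  if n is m.+1 then open_prob * (1 - (1 - desc_prob m) * (1 - desc_prob m)) else 1.

(** Lines with apex at [x] and lines below either child form three disjoint sets, so the recursion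
    for the probability is exact. *)
Lemma local_event_desc n x : local_event (below x) (desc n x) (desc_prob n).
Proof.
elim: n x => [|n IH] x /=.
  by split=> [|B _]; rewrite ?setTI ?mul1r.
have [fA <-] := apexed_void x.
apply: (@local_event_sub (apexed x `|` (below (child true x) `|` below (child false x)))).
  move=> l [/apexed_below//|[]]; exact: below_child.
apply: local_eventI; last 1 first.
- exact: local_eventU (below_children x) (IH _) (IH _).
- by rewrite setIUr !apexed_below_child setU0.
- exact: local_event_avoid.
Qed.

Lemma desc_decr n x : desc n.+1 x `<=` desc n x.
Proof.
elim: n x => [|n IH] x //= w [aw [h|h]]; split=> //; [left|right]; exact: IH.
Qed.

Lemma desc_le m n x : (m <= n)%N -> desc n x `<=` desc m x.
Proof.
by move=> /subnK <-; elim: (n - m)%N => [//|k IH] w; rewrite addSn => /desc_decr; exact: IH.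
Qed.

Definition surv (x : vertex) : set Omega := \bigcap_n desc n x.

(* Koenig's lemma: the events [desc n (child b x)] decrease with [n]. *)
Lemma surv_child x w : surv x w -> avoid (apexed x) w /\ exists b, surv (child b x) w.
Proof.
move=> sx; split; first by have [] := sx 1%N I.
apply: contrapT => nb.
have nx b : exists n, ~ desc n (child b x) w.
  by apply: contrapT => h; apply: nb; exists b => n _; apply: contrapT => h'; apply: h; exists n.
have [[m nm] [n nn]] := (nx true, nx false).
have [_ []] := sx (maxn m n).+1 I.
- by move=> /(@desc_le m _ _ (leq_maxl _ _)).
- by move=> /(@desc_le n _ _ (leq_maxr _ _)).
Qed.

Lemma open_prob_gt0 : 0 < open_prob.
Proof. exact: expR_gt0. Qed.

Lemma open_prob_le1 : open_prob <= 1.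
Proof. by rewrite -expR0 ler_expR oppr_le0; move: alpha_gt0; lra. Qed.

Lemma open_prob_half : (open_prob <= 2^-1) = (4 * ln 2 <= alpha).
Proof.
have -> : 2^-1 = expR (- ln 2) :> R by rewrite expRN lnK // posrE.
by rewrite ler_expR lerN2 ler_pdivlMr // mulrC.
Qed.

Lemma desc_prob_itv n : 0 <= desc_prob n <= 1.
Proof.
have p0 := open_prob_gt0; have p1 := open_prob_le1.
elim: n => [|n] /=; [by rewrite ler01 lexx|move: (desc_prob n) => q /andP[q0 q1]].
have ? : 0 <= (1 - q) * (1 - q) <= 1 by apply/andP; split; nra.
by rewrite mulr_ge0 1?mulr_ile1; lra.
Qed.

(** For [open_prob] at most 1/2 one generation sends q to at most q - q^2/2, whose iterates decay
    like 2/n. This covers the critical case as well. *)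
Lemma desc_prob_small n : 4 * ln 2 <= alpha -> desc_prob n.+1 <= 2 / n.+2%:R.
Proof.
rewrite -open_prob_half => ph; have p0 := open_prob_gt0; elim: n => [|n IH].
  by rewrite /= subrr mul0r subr0 mulr1 divff // (le_trans ph) // invf_le1 ?ler1n.
rewrite -[desc_prob _]/(open_prob * (1 - (1 - desc_prob n.+1) * (1 - desc_prob n.+1))).
have /andP[q0 q1] := desc_prob_itv n.+1; move: (desc_prob n.+1) q0 q1 IH => q q0 q1.
(* With s = 1/(n+2) the hypothesis is q <= 2s and the goal bound is 2s/(1+s). *)
have -> : 2 / n.+3%:R = 2 / n.+2%:R / (1 + n.+2%:R^-1) :> R.
  have n2 : n.+2%:R != 0 :> R by rewrite pnatr_eq0.
  have n3 : n.+3%:R != 0 :> R by rewrite pnatr_eq0.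
  have e : n.+3%:R = n.+2%:R + 1 :> R by rewrite -natr1.
  by rewrite e; move: n3; rewrite e => n3; field; apply/andP; split.
have : 0 < (n.+2%:R^-1 : R) by rewrite invr_gt0 ltr0n.
have : (n.+2%:R^-1 : R) <= 2^-1 by rewrite lef_pV2 ?posrE ?ltr0n // ler_nat.
move: (n.+2%:R^-1) => s s1 s0 qs.
rewrite ler_pdivlMr; last by lra.
have X0 : 0 <= 1 - (1 - q) * (1 - q) by nra.
have h1 : open_prob * (1 - (1 - q) * (1 - q)) <= q - q * q / 2.
  by apply: le_trans (ler_wpM2r X0 ph) _; lra.
(* The map q - q^2/2 increases on [0,1], and 2s <= 1. The next step is (2s - 2s^2)(1+s) = 2s(1 -
   s^2) <= 2s. *)
have h2 : q - q * q / 2 <= 2 * s - 2 * s * s by nra.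
apply: (@le_trans _ _ ((2 * s - 2 * s * s) * (1 + s))); last by nra.
by rewrite ler_wpM2r //; lra.
Qed.

Lemma desc_prob_decr n : desc_prob n.+1 <= desc_prob n.
Proof.
have p0 := open_prob_gt0; have p1 := open_prob_le1.
elim: n => [|n IH]; first by rewrite /= subrr mul0r subr0 mulr1.
rewrite -[leLHS]/(open_prob * (1 - (1 - desc_prob n.+1) * (1 - desc_prob n.+1))).
rewrite -[leRHS]/(open_prob * (1 - (1 - desc_prob n) * (1 - desc_prob n))).
rewrite ler_pM2l // lerB // ler_pM //; have := desc_prob_itv n; have := desc_prob_itv n.+1; lra.
Qed.

Lemma desc_prob_cvg : alpha < 4 * ln 2 ->
  exists2 c : R, 0 < c <= 1 & desc_prob @ \oo --> c.
Proof.
rewrite ltNge -open_prob_half -ltNge => ph.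
have p0 := open_prob_gt0; have p1 := open_prob_le1.
(* The nonzero fixed point of the recursion, positive exactly when [open_prob] exceeds 1/2. By
   monotonicity it bounds all iterates from below. *)
pose r := 2 - open_prob^-1.
have r0 : 0 < r by rewrite subr_gt0 -[ltRHS]invrK ltf_pV2 ?posrE ?invr_gt0.
have rq n : r <= desc_prob n.
  have pr : open_prob * (1 - (1 - r) * (1 - r)) = r by rewrite /r; field; rewrite gt_eqF.
  have r1 : r <= 1 by have : 1 <= open_prob^-1 by [rewrite invf_ge1]; rewrite /r; lra.
  elim: n => [//|n IH] /=; rewrite -[leLHS]pr ler_pM2l // lerB // ler_pM //.
  - by have := desc_prob_itv n; lra.
  - by have := desc_prob_itv n; lra.
  - by lra.
  - by lra.
have cv : cvgn desc_prob.
  apply: nonincreasing_is_cvgn; first by apply/nonincreasing_seqP; exact: desc_prob_decr.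
  by exists r => _ [n _ <-].
exists (limn desc_prob) => //; apply/andP; split.
  by apply: lt_le_trans r0 _; apply: limr_ge => //; exact: nearW.
by apply: limr_le => //; apply: nearW => n; have /andP[] := desc_prob_itv n.
Qed.

Lemma surv_measurable x : measurable (surv x).
Proof. by apply: bigcapT_measurable => n; have [] := local_event_desc n x. Qed.

Lemma surv_null x : 4 * ln 2 <= alpha -> P (surv x) = 0%E.
Proof.
move=> ha; rewrite PrE; last exact: surv_measurable.
congr (_%:E); apply/eqP; rewrite eq_le Pr_ge0 andbT.
apply/ler_addgt0Pr => e e0; rewrite add0r.
pose n := Num.truncn (2 / e).
have le : Pr (surv x) <= 2 / n.+2%:R.
  apply: le_trans (desc_prob_small n ha).
  rewrite -(local_event_Pr _ _ _ (local_event_desc n.+1 x)).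
  by apply: Pr_le; [exact: surv_measurable|exact: (local_event_desc n.+1 x).1|move=> w; exact].
apply: le_trans le _; rewrite ler_pdivrMr ?ltr0n // mulrC -ler_pdivrMr //.
have : 2 / e < n.+1%:R by apply: truncnS_gt.
by move=> /ltW/le_trans; apply; rewrite ler_nat.
Qed.

(** * Survival and vacant descending paths *)

Lemma vacant_avoid x w : vacant (Pi w) x -> avoid (apexed x) w.
Proof.
move=> vx; apply/seteqP; split=> // l [Pl [l1 l2]].
by have [/(vx l Pl)] := line_through_children l x l1 l2.
Qed.

Lemma vacant_extend (v p : vertex) a w : val v = rcons (val p) a ->
  avoid (apexed v) w -> avoid (lines_through v p) w -> vacant (Pi w) v.
Proof.
move=> vE av avp l Pl lv.
have [lp|nlp] := pselect (sval l p).
  by have : (Pi w `&` lines_through v p) l by []; rewrite avp.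
have lc := line_both_children l v p a lv vE nlp.
by have : (Pi w `&` apexed v) l by []; rewrite av.
Qed.

Lemma surv_descending x w : surv x w ->
  exists g, [/\ g 0%N = x, descending g & forall n, avoid (apexed (g n)) w].
Proof.
move=> sx; pose next y := if `[< surv (child true y) w >] then child true y else child false y.
have nextP y : surv y w -> surv (next y) w.
  move=> /surv_child[_ [b sb]]; rewrite /next; case: asboolP => // nt.
  by case: b sb.
have sn n : surv (iter n next x) w by elim: n => //= n /nextP.
exists (fun n => iter n next x); split=> // n; last by have [] := surv_child _ _ (sn n).
by rewrite iterS {1}/next; case: asbool; [exists true|exists false].
Qed.

Lemma descending_surv g w : descending g -> (forall n, avoid (apexed (g n)) w) ->
  surv (g 0%N) w.
Proof.
move=> gd av n _; suff H k : desc n (g k) w by [].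
elim: n k => [//|n IH] k; split; first exact: av.
by have [[] e] := gd k; rewrite -e; [left|right]; exact: IH.
Qed.

(** A vacant half-line makes some vertex survive, and there are countably many vertices, each
    surviving with probability zero. *)
Lemma no_half_line : 4 * ln 2 <= alpha ->
  {ae P, forall w, ~ exists H : set vertex, is_half_line H /\ H `<=` vacant (Pi w)}.
Proof.
move=> ha.
pose N n := if unpickle n is Some x then surv (x : vertex) else set0.
apply: (@negligibleS _ _ _ P (\bigcup_n N n)); last first.
  apply: negligible_bigcup => n; rewrite /N; case: unpickle => [x|]; last exact: negligible_set0.
  by apply/negligibleP; [exact: surv_measurable|exact: surv_null].
move=> w /contrapT[H [/half_line_descending[g [gd _ gH]] Hv]].
exists (pickle (g 0%N)) => //; rewrite /N pickleK.
by apply: descending_surv => // n; apply/vacant_avoid/Hv/gH.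
Qed.

(** * Vacant lines below the critical value *)

Definition bifurcation (y : vertex) : set Omega :=
  avoid (apexed y) `&` (surv (child true y) `&` surv (child false y)).

Lemma local_event_surv (c : R) x : desc_prob @ \oo --> c -> local_event (below x) (surv x) c.
Proof.
by apply: local_event_bigcap => n; [exact: local_event_desc|exact: desc_decr].
Qed.

Lemma local_event_bifurcation (c : R) y : desc_prob @ \oo --> c ->
  local_event (below y) (bifurcation y) (open_prob * (c * c)).
Proof.
move=> qc; have [fA <-] := apexed_void y.
apply: (@local_event_sub (apexed y `|` (below (child true y) `|` below (child false y)))).
  move=> l [/apexed_below//|[]]; exact: below_child.
apply: local_eventI; last 1 first.
- by apply: local_eventI (below_children y) _ _; exact: local_event_surv.
- by rewrite setIUr !apexed_below_child setU0.
- exact: local_event_avoid.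
Qed.

Lemma bifurcation_line (y p : vertex) a w : val y = rcons (val p) a ->
  avoid (lines_through y p) w -> bifurcation y w ->
  exists l : Lm, sval l `<=` vacant (Pi w).
Proof.
move=> yE yp [ay [/surv_descending[g [g0 gd ga]] /surv_descending[h [h0 hd ha]]]].
pose from_y (f : nat -> vertex) n := if n is m.+1 then f m else y.
have fd b f : f 0%N = child b y -> descending f -> descending (from_y f).
  by move=> f0 df [|n] /=; [exists b|exact: df].
have vac b f : f 0%N = child b y -> descending f -> (forall n, avoid (apexed (f n)) w) ->
    forall n, vacant (Pi w) (from_y f n).
  move=> f0 df fa; elim=> [|n IH] /=; first exact: vacant_extend yE ay yp.
  have [c e] := fd b f f0 df n; rewrite /= in e.
  apply: (@vacant_extend _ (from_y f n) (next_letter c (last 0 (val (from_y f n))))).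
  - by rewrite e.
  - exact: fa.
  (* The previous vertex is vacant, so no line of the process uses the edge from it. *)
  - by apply/seteqP; split=> // l [/IH + [_ +]].
have [l lP] := descending_pair_line (from_y g) (from_y h) (fd true g g0 gd)
  (fd false h h0 hd) erefl g0 h0.
by exists l => v /lP[n [->|->]]; [exact: vac g0 gd ga n|exact: vac h0 hd ha n].
Qed.

(** Disjointness of the [Z k] makes the failures independent, so [e] is the product of the
    [1 - c k]. Its nonnegativity is carried along to multiply the bounds. *)
Lemma local_event_none m (Z : nat -> set Lm) (G : nat -> set Omega) (c : nat -> R) delta :
  delta <= 1 ->
  (forall k, (k < m)%N -> local_event (Z k) (G k) (c k)) ->
  (forall k, (k < m)%N -> delta <= c k <= 1) ->
  (forall j k, (j < m)%N -> (k < m)%N -> j <> k -> Z j `&` Z k = set0) ->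
  exists2 e, e <= (1 - delta) ^+ m & 0 <= e /\
    local_event (\bigcup_(k in [set k | (k < m)%N]) Z k)
      [set w | forall k, (k < m)%N -> ~ G k w] e.
Proof.
move=> d1; elim: m => [|m IH] lG cd dis.
  exists 1; rewrite ?expr0 //; split=> //.
  have -> : [set w | forall k, (k < 0)%N -> ~ G k w] = setT by apply/seteqP; split.
  by split=> [|B _]; rewrite ?setTI ?mul1r.
have [k km|k km|j k jm km|e em [e0 le]] := IH.
- exact: lG (ltnW km).
- exact: cd (ltnW km).
- exact: dis (ltnW jm) (ltnW km).
have /andP[dc c1] := cd m (ltnSn m).
exists (e * (1 - c m)).
  by rewrite exprSr ler_pM // ?subr_ge0 // lerB.
split; first by rewrite mulr_ge0 // subr_ge0.
have -> : \bigcup_(k in [set k | (k < m.+1)%N]) Z k =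
    \bigcup_(k in [set k | (k < m)%N]) Z k `|` Z m.
  apply/seteqP; split=> l.
    move=> [k /=]; rewrite ltnS leq_eqVlt => /predU1P[->|km]; first by right.
    by left; exists k.
  by move=> [[k /= km lk]|lm]; [exists k => //=; exact: ltnW|exists m => /=].
have -> : [set w | forall k, (k < m.+1)%N -> ~ G k w] =
    [set w | forall k, (k < m)%N -> ~ G k w] `&` ~` G m.
  apply/seteqP; split=> w /=.
    by move=> h; split=> [k km|]; apply: h => //; exact: ltnW.
  by move=> [h1 h2] k; rewrite ltnS leq_eqVlt => /predU1P[->//|]; exact: h1.
apply: local_eventI => //; last exact/local_eventC/lG.
apply/seteqP; split=> // l [[k /= km lk] lm].
have : (Z k `&` Z m) l by [].
by rewrite dis //; [exact: ltnW|lia].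
Qed.

Definition small (A : set Lm) (e : R) := fin_meas A /\ fine (mu A) <= e.

Lemma small_bigsetU (A : nat -> set Lm) e n : (forall i, small (A i) e) ->
  small (\big[setU/set0]_(i < n) A i) (n%:R * e).
Proof.
move=> sA; elim: n => [|n [fU Ue]].
  by rewrite big_ord0 mul0r /small /fin_meas measure0.
have [fn ne] := sA n.
have fU1 := fin_measU _ _ fU fn; rewrite big_ord_recr /=; split=> //.
rewrite -natr1 mulrDl mul1r; apply: le_trans (lerD Ue ne).
rewrite -fineD ?ge0_fin_numE ?fU.2 ?fn.2 //.
apply: fine_le; rewrite ?ge0_fin_numE ?adde_ge0 ?fU1.2 //.
  by rewrite lte_add_pinfty ?fU.2 ?fn.2.
exact: (measureU2 mu fU.1 fn.1).
Qed.

Lemma void_prob_ge A e : small A e -> 1 - alpha * e <= void_prob A.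
Proof.
move=> [_ Ae]; apply: le_trans (expR_ge1Dx _).
by rewrite lerD2l lerN2 ler_pM2l.
Qed.

Lemma void_prob_le1 A : void_prob A <= 1.
Proof. by rewrite -expR0 ler_expR oppr_le0 mulr_ge0 ?fine_ge0 // ltW. Qed.

Lemma no_line_bound (c : R) m L : desc_prob @ \oo --> c -> 0 < c <= 1 -> (0 < L)%N ->
  let delta := expR (- (alpha / 2)) * (open_prob * (c * c)) in
  exists H, [/\ measurable H,
    forall w, ~ (exists l : Lm, sval l `<=` vacant (Pi w)) -> H w &
    Pr H <= (1 - delta) ^+ m + alpha * (m%:R * (m%:R * 2 ^- L))].
Proof.
move=> qc /andP[c0 c1] L0 delta.
(* Distinct [y k] are at distance at least L + 2, so the lines through two given ones have measure
   at most [2 ^- L]. *)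
pose y k := side (k * L); pose p k := alt_v false (k * L).
have yp k : val (y k) = rcons (val (p k)) (2 : 'I_3) by [].
have mulL j k : j <> k -> (j * L <> k * L)%N.
  by move=> jk e; apply: jk; apply/eqP; rewrite -(eqn_pmul2r L0) e.
have yNprec j k : j <> k -> ~~ prec (y j) (y k) by move/mulL/side_Nprec.
pose A j k := if j == k then set0 else lines_through (y j) (y k).
have sA j k : small (A j k) (2 ^- L).
  rewrite /A; case: eqP => [_|jk]; first by rewrite /small /fin_meas measure0 /= invr_ge0 exprn_ge0.
  have ne : y j <> y k by move=> e; have := yNprec j k jk; rewrite e /prec prefix_refl.
  split; first by have [] := lines_through_void _ _ ne.
  rewrite muE //= lef_pV2 ?posrE ?exprn_gt0 // ler_weXn2l ?ler1n // dist_side; last exact: mulL.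
  have [lt|lt|//] := ltngtP j k.
    by have := leq_mul lt (leqnn L); rewrite mulSn; lia.
  by have := leq_mul lt (leqnn L); rewrite mulSn; lia.
(* Removing the lines through two of the [y k] makes the sets [B k] disjoint. *)
pose O := \big[setU/set0]_(j < m) \big[setU/set0]_(k < m) A j k.
have [fO Ole] : small O (m%:R * (m%:R * 2 ^- L)).
  by apply: (@small_bigsetU (fun j => \big[setU/set0]_(k < m) A j k)) => j; exact: small_bigsetU.
have OP j k l : (j < m)%N -> (k < m)%N -> j <> k -> sval l (y j) -> sval l (y k) -> O l.
  move=> jm km jk lj lk; rewrite /O -(bigcup_mkord m (fun j => \big[setU/set0]_(k < m) A j k)).
  by exists j => //; rewrite -bigcup_mkord; exists k => //; rewrite /A; case: eqP jk.
pose B k := lines_through (y k) (p k) `\` O.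
have yNp k : ~~ prec (y k) (p k).
  by apply/negP => /size_prefix; rewrite /= size_rcons ltnn.
have ypD k : y k <> p k by move=> e; have := yNp k; rewrite e /prec prefix_refl.
have fB k : fin_meas (B k) /\ expR (- (alpha / 2)) <= void_prob (B k).
  have [[mYP fYP] _] := lines_through_void _ _ (ypD k).
  have mB : measurable (B k) by apply: measurableD => //; exact: fO.1.
  have Ble : (mu (B k) <= mu (lines_through (y k) (p k)))%E.
    by apply: le_measure; rewrite ?inE //; move=> l [].
  have fB : (mu (B k) < +oo)%E by exact: le_lt_trans Ble fYP.
  split=> //; rewrite ler_expR lerN2 ler_pM2l // -lee_fin fineK ?ge0_fin_numE //.
  apply: le_trans Ble _; rewrite muE // dist_sym dist_prefix /=; last exact: prefix_rcons.
  by rewrite size_rcons subSnn expr1.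
pose G k := avoid (B k) `&` bifurcation (y k).
pose Z k := B k `|` below (y k).
have lG k : local_event (Z k) (G k) (void_prob (B k) * (open_prob * (c * c))).
  apply: local_eventI; [|exact: local_event_avoid (fB k).1|exact: local_event_bifurcation].
  by apply/seteqP; split=> // l [[[_ lp] _] /(_ _ lp)]; rewrite (negbTE (yNp k)).
have o0 := open_prob_gt0; have o1 := open_prob_le1.
have occ : 0 < open_prob * (c * c) <= 1.
  by rewrite !mulr_gt0 //= !mulr_ile1 ?mulr_ge0 // ltW.
have [//|k _|k _|j k jm km jk|e eD [_ lE]] := @local_event_none m Z G
    (fun k => void_prob (B k) * (open_prob * (c * c))) delta.
- have /andP[/ltW o2 o3] := occ; rewrite /delta mulr_ile1 ?expR_ge0 //.
  by rewrite -expR0 ler_expR oppr_le0 divr_ge0 // ltW.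
- exact: lG.
- have /andP[/ltW o2 o3] := occ; have [_ h] := fB k; apply/andP; split.
    by rewrite ler_wpM2r.
  by rewrite mulr_ile1 ?expR_ge0 ?void_prob_le1.
(* A line in both [B j] and [B k] hits [y j] and [y k], hence lies in [O]. In the other cases one of
   [y j], [y k] would be an ancestor of the other. *)
- apply/seteqP; split=> // l [[[[lj lpj] nO]|bj] [[[lk _] _]|bk]].
  + by apply: nO; exact: (OP j k).
  + by move: (bk _ lj); apply/negP/yNprec => /esym.
  + by move: (bj _ lk); apply/negP/yNprec.
  + have [v lv] := line_inh l.
    by case: (prec_comparable _ _ _ (bj _ lv) (bk _ lv)); apply/negP/yNprec => // /esym.
have [mO PO] := avoidP _ fO.
exists ([set w | forall k, (k < m)%N -> ~ G k w] `|` ~` avoid O); split.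
- by apply: measurableU; [exact: lE.1|exact: measurableC].
- move=> w nl; apply: contrapT => /not_orP[/= h /contrapT aO]; apply: h => k km [aB bif].
  apply: nl; apply: bifurcation_line (yp k) _ bif.
  apply/seteqP; split=> // l [Pl lyp].
  have [Ol|nO] := pselect (O l); first by rewrite -aO.
  by rewrite -aB.
- apply: le_trans (PrU _ _ lE.1 (measurableC mO)) _; apply: lerD.
    by rewrite (local_event_Pr _ _ _ lE).
  rewrite -[~` _]setIT PrC // PrT setIT PO.
  by have := @void_prob_ge O _ (conj fO Ole); lra.
Qed.

Lemma negligible_approx (N : set Omega) :
  (forall e : R, 0 < e -> exists H, [/\ measurable H, N `<=` H & Pr H <= e]) ->
  P.-negligible N.
Proof.
move=> app; have app' n : exists H, [/\ measurable H, N `<=` H & Pr H <= n.+1%:R^-1].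
  by apply: app; rewrite invr_gt0.
have [F FP] := choice app'.
have mF : measurable (\bigcap_n F n) by apply: bigcapT_measurable => n; have [] := FP n.
exists (\bigcap_n F n); split=> //; last by move=> w Nw n _; have [_ + _] := FP n; apply.
rewrite PrE //; congr (_%:E); apply/eqP; rewrite eq_le Pr_ge0 andbT.
apply/ler_addgt0Pr => e e0; rewrite add0r.
have [mn _ le] := FP (Num.truncn e^-1).
apply: (@le_trans _ _ (Pr (F (Num.truncn e^-1)))); first by apply: Pr_le => // w; exact.
by apply: le_trans le _; rewrite -[leRHS]invrK lef_pV2 ?posrE ?invr_gt0 // ltW // truncnS_gt.
Qed.

(** First [m] is taken large to make the independent failures unlikely, then [L], depending on [m],
    to make the lines through two turning points rare. *)
Lemma vacant_line : alpha < 4 * ln 2 ->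
  {ae P, forall w, exists l : Lm, sval l `<=` vacant (Pi w)}.
Proof.
move=> ha; have [c c01 qc] := desc_prob_cvg ha.
apply: negligible_approx => e e0.
pose delta := expR (- (alpha / 2)) * (open_prob * (c * c)).
have o0 := open_prob_gt0; have /andP[c0 c1] := c01.
have d0 : 0 < delta by rewrite !mulr_gt0 // expR_gt0.
have d1 : delta <= 1.
  rewrite /delta !mulr_ile1 ?mulr_ge0 ?expR_ge0 ?open_prob_le1 // ?(ltW o0) ?(ltW c0) //.
  by rewrite -expR0 ler_expR oppr_le0 divr_ge0 // ltW.
have small_pow (z : R) : 0 <= z < 1 -> forall t : R, 0 < t -> exists n, z ^+ n.+1 <= t.
  move=> /andP[z0 z1] t t0.
  have zc : (GRing.exp z : R^nat) @ \oo --> (0 : R) by apply: cvg_expr; rewrite ger0_norm.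
  have /cvgr0Pnorm_le/(_ t t0)[N _ NP] := zc.
  by exists N; have := NP N.+1 (leqnSn N); apply: le_trans; exact: ler_norm.
have e2 : 0 < e / 2 by rewrite divr_gt0.
have [|m mP] := small_pow (1 - delta) _ _ e2; first by apply/andP; split; lra.
have K0 : 0 < alpha * (m.+1%:R * m.+1%:R) by rewrite !mulr_gt0.
have [|L LP] := small_pow 2^-1 _ _ (divr_gt0 e2 K0); first by apply/andP; split; lra.
have [H [mH HP HL]] := @no_line_bound c m.+1 L.+1 qc c01 isT.
exists H; split=> //; apply: le_trans HL _; rewrite [leRHS](splitr e).
apply: lerD; first exact: mP.
by move: LP; rewrite ler_pdivlMr // exprVn mulrC; apply: le_trans; rewrite !mulrA.
Qed.
End Avoidance.

Theorem theorem1 (R : realType) (mu : {measure set Lm -> \bar R}) :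
  (forall x y : vertex, x <> y ->
     mu (lines_through x y) = ((2 : R) ^- dist x y)%:E) ->
  forall (d : measure_display) (Omega : measurableType d)
         (P : probability Omega R) (alpha : R) (Pi : Omega -> set Lm),
  0 < alpha ->
  poisson_process P alpha mu Pi ->
  (alpha < 4 * ln 2 ->
     {ae P, forall w, exists l : Lm, proj1_sig l `<=` vacant (Pi w)}) /\
  (4 * ln 2 <= alpha ->
     {ae P, forall w, ~ exists H : set vertex, is_half_line H /\ H `<=` vacant (Pi w)}).
Proof.
move=> muE d Omega P alpha Pi alpha_gt0 PiP; split.
- exact: (vacant_line alpha_gt0 PiP muE).
- exact: (no_half_line alpha_gt0 PiP muE).
Qed.
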